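(* Let $\alpha>0$, $L>0$, and let $\mathcal{H}$ be an infinite dimensional Hilbert space with fixed orthonormal basis $\{|e_0\rangle,|e_1\rangle,\dots\}$. Consider the quantum Gaussian model $$\mathcal{G}_n=\left\{|G(\sqrt n\psi)\rangle\langle G(\sqrt n\psi)|:\ |\psi\rangle\in\mathcal{H}\text{ such that }|\psi\rangle\langle\psi|\in S^\alpha(L)\right\}$$ of coherent states on the Fock space $\mathcal{F}(\mathcal{H})$. There exists a constant $c>0$ depending only on $\alpha$ and $L$ such that $$\liminf_{n\to\infty}\ \inf_{\widehat\psi_n}\ \sup_{\psi\in S^\alpha(L)} n^{2\alpha/(2\alpha+1)}\,\mathbb{E}_\psi\left[\|\widehat\psi_n-\psi\|_2^2\right]\ge c,$$ where the infimum is taken over all estimators $\widehat\psi_n$, understood as combinations of measurements and classical estimators.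
   Context: The Hermite-Sobolev class is $S^\alpha(L)=\{|\psi\rangle\langle\psi|:\ \sum_{j=0}^\infty|\psi_j|^2j^{2\alpha}\le L,\ \|\psi\|=1\}$, where $\psi_j=\langle e_j|\psi\rangle$. Here $\psi\in S^\alpha(L)$ means that $\psi\in\mathcal{H}$ is a vector with $|\psi\rangle\langle\psi|\in S^\alpha(L)$, and $\|\cdot\|_2$ is the Hilbert space norm of $\mathcal{H}$ (the $\ell_2$ norm of the coefficients). The (symmetric) Fock space over $\mathcal{K}$ is $\mathcal{F}(\mathcal{K})=\bigoplus_{n\ge0}\mathcal{K}^{\otimes_s n}$ ($n$-fold symmetric tensor products, $\mathcal{K}^{\otimes_s0}=\mathbb{C}|0\rangle$), and for $v\in\mathcal{K}$ the coherent state is $|G(v)\rangle=e^{-\|v\|^2/2}\bigoplus_{n\ge0}\frac1{\sqrt{n!}}|v\rangle^{\otimes n}$. An estimator $\widehat\psi_n$ is an $\mathcal{H}$-valued random element obtained by performing a measurement (a positive operator valued measure $M$ on $\mathcal{F}(\mathcal{H})$: $M(E)\ge0$, $\sigma$-additive, total mass $\mathbf 1$) and applying a classical estimator to the outcome; the outcome has law $E\mapsto\langle G(\sqrt n\psi)|M(E)|G(\sqrt n\psi)\rangle$, and $\mathbb{E}_\psi$ is the corresponding expectation. *)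

(* Defs.v *)
(* Inner products are instances of {dot _ for Num.conj}: linear in
   the FIRST and conjugate-linear in the second argument, so that the physics
   bracket <x|y> is written dot y x. *)
From HB Require Import structures.
From mathcomp Require Import all_boot all_order all_algebra.
From mathcomp Require Import complex lra.
From mathcomp Require Import all_classical all_reals all_analysis.

Set Implicit Arguments.
Unset Strict Implicit.
Unset Printing Implicit Defensive.

Import Order.TTheory GRing.Theory Num.Theory.
Import numFieldNormedType.Exports Normc.

Local Open Scope classical_set_scope.
Local Open Scope ring_scope.
Local Open Scope complex_scope.

Section absolutely_convergent_sums.
Context {R : realType} {T : choiceType}.
Implicit Types (u v : T -> R) (f g : T -> R[i]).

(* Sum of an absolutely summable real family indexed by a (countably) infinite
   type, as positive part minus negative part. *)
Definition rsum u : R :=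
  fine (\esum_(i in setT) (EFin \o u)^\+ i - \esum_(i in setT) (EFin \o u)^\- i).

Definition csum f : R[i] :=
  rsum (fun i => complex.Re (f i)) +i* rsum (fun i => complex.Im (f i)).

Definition rsummable u := summable [set: T] (EFin \o u).

Lemma summable_le u v : (forall i, `|u i| <= v i) -> rsummable v -> rsummable u.
Proof.
move=> uv; apply: le_lt_trans; apply: le_esum => i _ /=; rewrite lee_fin.
exact: le_trans (ler_norm _).
Qed.

Lemma esumZ (D : set T) (c : R) (a : T -> \bar R) : 0 <= c ->
  (forall i, 0 <= a i)%E ->
  (\esum_(i in D) (c%:E * a i) = c%:E * \esum_(i in D) a i)%E.
Proof.
rewrite le_eqVlt => /predU1P[<- a0|c0 a0].
  by rewrite mul0e esum1// => i _; rewrite mul0e.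
have main (d : R) (b : T -> \bar R) : 0 < d -> (forall i, 0 <= b i)%E ->
    (\esum_(i in D) (d%:E * b i) <= d%:E * \esum_(i in D) b i)%E.
  move=> d0 b0; apply: ge_ereal_sup => _ [F [finF FD] <-].
  rewrite -ge0_mule_fsumr//; apply: lee_wpmul2l; first by rewrite lee_fin ltW.
  by apply: esum_ge; exists F.
apply/eqP; rewrite eq_le main//= -[leRHS]mul1e.
rewrite -(@divff _ c) ?gt_eqF// EFinM -muleA.
apply: lee_wpmul2l; first by rewrite lee_fin ltW.
apply: le_trans (main c^-1 (fun i => c%:E * a i)%E _ _); last 2 first.
- by rewrite invr_gt0.
- by move=> i; rewrite mule_ge0// lee_fin ltW.
apply: le_esum => i _.
by rewrite muleA -EFinM mulVf ?gt_eqF// mul1e.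
Qed.

Lemma rsummableD u v : rsummable u -> rsummable v -> rsummable (u \+ v).
Proof. by move=> su sv; have := summableD su sv. Qed.

Lemma rsummableN u : rsummable u -> rsummable (\- u).
Proof. by rewrite /rsummable summableN. Qed.

Let fin (c : T -> R) : (forall i, 0 <= c i) -> rsummable c ->
    (\esum_(i in setT) (c i)%:E)%E \is a fin_num.
Proof.
move=> c0; rewrite /rsummable summableE.
by under eq_esum do rewrite /= ger0_norm//.
Qed.

Lemma rsumE (a b u : T -> R) : rsummable a -> rsummable b ->
  (forall i, 0 <= a i) -> (forall i, 0 <= b i) -> (forall i, u i = a i - b i) ->
  rsum u = fine (\esum_(i in setT) (a i)%:E) - fine (\esum_(i in setT) (b i)%:E).
Proof.
move=> sa sb a0 b0 uab; rewrite /rsum.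
have -> : EFin \o u = ((EFin \o a) \- (EFin \o b))%E.
  by apply/funext => i /=; rewrite uab EFinB.
rewrite esumB//; try by move=> i _ /=; rewrite lee_fin.
by rewrite fineB// fin.
Qed.

Let pos u := fun i => Num.max (u i) 0.
Let neg u := fun i => Num.max (- u i) 0.
Let pos_ge0 u i : 0 <= pos u i. Proof. by rewrite le_max lexx orbT. Qed.
Let neg_ge0 u i : 0 <= neg u i. Proof. by rewrite le_max lexx orbT. Qed.
Let posneg u i : u i = pos u i - neg u i.
Proof.
rewrite /pos /neg; have [u0|/ltW u0] := leP 0 (u i).
  by rewrite [X in _ - X]max_r ?subr0// oppr_le0.
by rewrite [X in _ - X]max_l ?oppr_ge0// opprK add0r.
Qed.
Let pos_summable u : rsummable u -> rsummable (pos u).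
Proof.
move=> su; apply: (@summable_le _ (fun i => `|u i|)).
  by move=> i; rewrite ger0_norm ?pos_ge0// /pos ge_max ler_norm normr_ge0.
by apply: le_lt_trans su; apply: le_esum => i _ /=; rewrite normr_id.
Qed.
Let neg_summable u : rsummable u -> rsummable (neg u).
Proof. by move=> su; apply: (@pos_summable (\- u)); exact: rsummableN. Qed.

Lemma rsumD u v : rsummable u -> rsummable v ->
  rsum (fun i => u i + v i) = rsum u + rsum v.
Proof.
move=> su sv.
rewrite (@rsumE (pos u \+ pos v) (neg u \+ neg v)); last 5 first.
- by apply: rsummableD; exact: pos_summable.
- by apply: rsummableD; exact: neg_summable.
- by move=> i /=; rewrite addr_ge0.
- by move=> i /=; rewrite addr_ge0.
- by move=> i /=; rewrite {1}(posneg u) {1}(posneg v) opprD addrACA.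
rewrite (@rsumE (pos u) (neg u) u)//; try exact: pos_summable; try exact: neg_summable; try exact: posneg.
rewrite (@rsumE (pos v) (neg v) v)//; try exact: pos_summable; try exact: neg_summable; try exact: posneg.
have D (a b : T -> R) : (forall i, 0 <= a i) -> (forall i, 0 <= b i) ->
   rsummable a -> rsummable b ->
   fine (\esum_(i in setT) ((a \+ b) i)%:E) =
   fine (\esum_(i in setT) (a i)%:E) + fine (\esum_(i in setT) (b i)%:E).
  move=> a0 b0 sa sb; rewrite -fineD ?fin//.
  by rewrite -esumD// => i _; rewrite lee_fin.
rewrite (D _ _ (pos_ge0 u) (pos_ge0 v) (pos_summable su) (pos_summable sv)).
rewrite (D _ _ (neg_ge0 u) (neg_ge0 v) (neg_summable su) (neg_summable sv)).
by rewrite opprD addrACA.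
Qed.

Lemma rsumN u : rsummable u -> rsum (fun i => - u i) = - rsum u.
Proof.
move=> su.
rewrite (@rsumE (pos u) (neg u) u)//; try exact: pos_summable; try exact: neg_summable; try exact: posneg.
rewrite (@rsumE (neg u) (pos u) (fun i => - u i))//; try exact: pos_summable; try exact: neg_summable.
  by rewrite opprB.
by move=> i; rewrite {1}posneg opprB.
Qed.

Lemma rsum0 : rsum (fun=> 0) = 0.
Proof.
by rewrite (@rsumE (fun=> 0) (fun=> 0) (fun=> 0)) ?subrr//; try (by move=> i; rewrite subrr);
  rewrite /rsummable /summable esum1// => i _ /=; rewrite normr0.
Qed.

Lemma rsummableZ (c : R) u : rsummable u -> rsummable (fun i => c * u i).
Proof.
move=> su; rewrite /rsummable /summable.
under eq_esum => i _ do rewrite /= normrM EFinM.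
by rewrite (@esumZ _ _ (fun i => `|u i|%:E))// lte_mul_pinfty// lee_fin.
Qed.

Lemma rsumZ (c : R) u : rsummable u -> rsum (fun i => c * u i) = c * rsum u.
Proof.
have Zpos (d : R) v : 0 < d -> rsummable v -> rsum (fun i => d * v i) = d * rsum v.
  move=> d0 sv.
  rewrite (@rsumE (pos v) (neg v) v)//; try exact: pos_summable; try exact: neg_summable; try exact: posneg.
  rewrite (@rsumE (fun i => d * pos v i) (fun i => d * neg v i) (fun i => d * v i)).
  - have E (a : T -> R) : (forall i, 0 <= a i) -> rsummable a ->
        fine (\esum_(i in setT) (d * a i)%:E) = d * fine (\esum_(i in setT) (a i)%:E).
      move=> a0 sa; under eq_esum do rewrite EFinM.
      by rewrite (@esumZ _ _ (fun i => (a i)%:E)) ?fineM ?fin// ltW.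
    rewrite (E _ (pos_ge0 v) (pos_summable sv)).
    by rewrite (E _ (neg_ge0 v) (neg_summable sv)) mulrBr.
  - exact/rsummableZ/pos_summable.
  - exact/rsummableZ/neg_summable.
  - by move=> i; rewrite mulr_ge0// ltW.
  - by move=> i; rewrite mulr_ge0// ltW.
  - by move=> i; rewrite {1}(posneg v) mulrBr.
move=> su; have [c0|c0|->] := ltgtP c 0; last 2 first.
- exact: Zpos.
- by rewrite mul0r (_ : (fun i => 0 * u i) = fun=> 0) ?rsum0//; apply/funext => i; rewrite mul0r.
have {1}-> : c = - - c by rewrite opprK.
under [X in rsum X]funext do rewrite mulNr.
rewrite rsumN; last exact: rsummableZ.
by rewrite Zpos ?oppr_gt0// mulNr opprK.
Qed.

Lemma rsum_ge0E u : (forall i, 0 <= u i) -> rsummable u ->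
  rsum u = fine (\esum_(i in setT) (u i)%:E).
Proof.
move=> u0 su; rewrite (@rsumE u (fun=> 0) u)//.
- by rewrite [X in _ - fine X]esum1// subr0.
- by rewrite /rsummable /summable esum1// => i _ /=; rewrite normr0.
- by move=> i; rewrite subr0.
Qed.

End absolutely_convergent_sums.

Section csum.
Context {R : realType} {T : choiceType}.
Implicit Types f g : T -> R[i].

Definition csummable f := summable [set: T] (fun i => (normc (f i))%:E).

Lemma normc_ge0 (z : R[i]) : 0 <= normc z.
Proof. by case: z => a b; exact: sqrtr_ge0. Qed.

Lemma normcE2 (z : R[i]) : normc z ^+ 2 = complex.Re z ^+ 2 + complex.Im z ^+ 2.
Proof. by case: z => a b /=; rewrite sqr_sqrtr// addr_ge0// sqr_ge0. Qed.

Lemma normc_conj (z : R[i]) : normc z^*%C = normc z.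
Proof. by case: z => a b /=; rewrite sqrrN. Qed.

Lemma Re_summable f : csummable f ->
  summable [set: T] (EFin \o (fun i => complex.Re (f i))).
Proof.
apply: summable_le => i; rewrite -(ler_pXn2r (ltn0Sn 1)) ?nnegrE ?normc_ge0//.
by rewrite normcE2 real_normK ?num_real// lerDl sqr_ge0.
Qed.

Lemma Im_summable f : csummable f ->
  summable [set: T] (EFin \o (fun i => complex.Im (f i))).
Proof.
apply: summable_le => i; rewrite -(ler_pXn2r (ltn0Sn 1)) ?nnegrE ?normc_ge0//.
by rewrite normcE2 real_normK ?num_real// lerDr sqr_ge0.
Qed.

Lemma csumD f g : csummable f -> csummable g ->
  csum (fun i => f i + g i) = csum f + csum g.
Proof.
move=> sf sg; have sfr := Re_summable sf; have sfi := Im_summable sf.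
have sgr := Re_summable sg; have sgi := Im_summable sg.
apply/eqP; rewrite eq_complex /= -(rsumD sfr sgr) -(rsumD sfi sgi).
by apply/andP; split; apply/eqP; congr rsum; apply/funext => i; case: (f i) (g i) => [a b] [].
Qed.

Lemma csumZ (c : R[i]) f : csummable f ->
  csum (fun i => c * f i) = c * csum f.
Proof.
move=> sf; have sr := Re_summable sf; have si := Im_summable sf.
case: c => a b; apply/eqP; rewrite eq_complex /csum /=.
have EX1 : (fun i => complex.Re ((a +i* b) * f i)) =
   (fun i => a * complex.Re (f i) + (- b) * complex.Im (f i)).
  by apply/funext => i; case: (f i) => x y /=; rewrite mulNr.
have EX2 : (fun i => complex.Im ((a +i* b) * f i)) =
   (fun i => a * complex.Im (f i) + b * complex.Re (f i)).
  by apply/funext => i; case: (f i) => x y /=.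
rewrite EX1 EX2 !rsumD; try exact: rsummableZ.
by rewrite !rsumZ// mulNr !eqxx.
Qed.

Lemma csum_conj f : csummable f -> csum (fun i => (f i)^*) = (csum f)^*.
Proof.
move=> sf; rewrite /csum /= -rsumN; last exact: Im_summable.
by congr Complex; congr rsum; apply/funext => i; case: (f i).
Qed.

End csum.

Section fock_space.
Variable R : realType.
Local Notation C := R[i].
Implicit Types f g : seq nat -> C.

(* The Fock space F(H) = (+)_n H^{(x)_s n} over a Hilbert space H with
   orthonormal basis (e_j)_j. The vectors e_{j_1} (x) ... (x) e_{j_n} form an
   orthonormal basis of the full tensor power H^{(x) n}, hence words
   s = [:: j_1; ...; j_n] of length n index a basis of H^{(x) n} and words of
   all lengths index a basis of the Hilbert direct sum of the H^{(x) n}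
   (the empty word being the vacuum). A vector is given by its square-summable
   coefficients; it lies in the symmetric tensor powers iff its coefficients
   are invariant under permutation of the letters. *)
Definition fock_pred : {pred seq nat -> C} := mem [set f |
  (forall s t, perm_eq s t -> f s = f t) /\
  (\esum_(s in [set: seq nat]) (normc (f s) ^+ 2)%:E < +oo)%E].

Record fock := Fock {
  fock_coef :> seq nat -> C;
  fock_coefP : fock_coef \in fock_pred }.

HB.instance Definition _ := [isSub for fock_coef].
HB.instance Definition _ := [Choice of fock by <:].

Lemma normcD2 (z w : C) : normc (z + w) ^+ 2 <= 2 * normc z ^+ 2 + 2 * normc w ^+ 2.
Proof.
rewrite !normcE2; case: z w => [a b] [c d] /=.
have := sqr_ge0 (a - c); have := sqr_ge0 (b - d); rewrite !expr2; lra.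
Qed.

Lemma sqsummableZ (c : C) f :
  (\esum_(s in [set: seq nat]) (normc (f s) ^+ 2)%:E < +oo)%E ->
  (\esum_(s in [set: seq nat]) (normc (c * f s) ^+ 2)%:E < +oo)%E.
Proof.
move=> h; under eq_esum do rewrite normcM exprMn EFinM.
rewrite (@esumZ _ _ _ (normc c ^+ 2) (fun s => (normc (f s) ^+ 2)%:E)).
- by rewrite lte_mul_pinfty// lee_fin sqr_ge0.
- exact: sqr_ge0.
- by move=> s; rewrite lee_fin sqr_ge0.
Qed.

Lemma sqsummableD f g :
  (\esum_(s in [set: seq nat]) (normc (f s) ^+ 2)%:E < +oo)%E ->
  (\esum_(s in [set: seq nat]) (normc (g s) ^+ 2)%:E < +oo)%E ->
  (\esum_(s in [set: seq nat]) (normc (f s + g s) ^+ 2)%:E < +oo)%E.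
Proof.
move=> hf hg.
apply: (@le_lt_trans _ _ (\esum_(s in [set: seq nat])
   (2%:E * ((normc (f s) ^+ 2)%:E + (normc (g s) ^+ 2)%:E)))%E).
  apply: le_esum => s _; rewrite -EFinD -EFinM lee_fin mulrDr; exact: normcD2.
rewrite (@esumZ _ _ _ 2 (fun s => ((normc (f s) ^+ 2)%:E + (normc (g s) ^+ 2)%:E)%E))//; last first.
  by move=> s; rewrite -EFinD lee_fin addr_ge0// sqr_ge0.
rewrite esumD; try by move=> s _; rewrite lee_fin sqr_ge0.
by rewrite lte_mul_pinfty// lte_add_pinfty.
Qed.

Lemma fock_submod_closed : GRing.submod_closed fock_pred.
Proof.
split.
  apply/mem_set; split=> //.
  rewrite esum1// => s _; have -> : normc ((0 : seq nat -> C) s) = 0 by exact: normc0.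
  by rewrite expr0n.
move=> c f g; rewrite !inE /= => -[pf sf] [pg sg]; split.
  by move=> s t st; rewrite !fctE (pf _ _ st) (pg _ _ st).
by apply: sqsummableD => //; exact: sqsummableZ.
Qed.

HB.instance Definition _ := GRing.isSubmodClosed.Build C (seq nat -> C) fock_pred
  fock_submod_closed.
HB.instance Definition _ := [SubChoice_isSubLmodule of fock by <:].

Definition fock_dot (x y : fock) : C := csum (fun s => x s * (y s)^*).

Lemma fock_dot_summable (x y : fock) : csummable (fun s => x s * (y s)^*).
Proof.
have /set_mem[_ sx] := fock_coefP x; have /set_mem[_ sy] := fock_coefP y.
apply: (@le_lt_trans _ _ (\esum_(s in [set: seq nat])
   (((normc (x s) ^+ 2)%:E + (normc (y s) ^+ 2)%:E)))%E).
  apply: le_esum => s _; rewrite -EFinD lee_fin ger0_norm ?normc_ge0//.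
  rewrite normcM normc_conj; set p := normc _; set q := normc _.
  have p0 : 0 <= p := normc_ge0 _; have q0 : 0 <= q := normc_ge0 _.
  have := sqr_ge0 (p - q); have := mulr_ge0 p0 q0; rewrite !expr2; lra.
rewrite esumD; try by move=> s _; rewrite lee_fin sqr_ge0.
by rewrite lte_add_pinfty.
Qed.

Lemma fock_dotDZ c x x' y : fock_dot (c *: x + x') y = c * fock_dot x y + fock_dot x' y.
Proof.
rewrite /fock_dot -(csumZ c (fock_dot_summable x y)).
rewrite -csumD; last 2 first.
- have := fock_dot_summable x y; rewrite /csummable => h.
  have := @rsummableZ R (seq nat) (normc c) _ h.
  by apply: le_lt_trans; apply: le_esum => s _; rewrite normcM.
- exact: fock_dot_summable.
congr csum; apply/funext => s.
by rewrite mulrA -mulrDl.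
Qed.

Lemma fock_dotC x y : fock_dot x y = (fock_dot y x)^*.
Proof.
rewrite /fock_dot -csum_conj; last exact: fock_dot_summable.
by congr csum; apply/funext => s; rewrite rmorphM/= conjcK mulrC.
Qed.

Lemma fock_dotxx x : fock_dot x x =
  (fine (\esum_(s in [set: seq nat]) (normc (x s) ^+ 2)%:E))%:C.
Proof.
rewrite /fock_dot /csum; congr Complex.
  rewrite rsum_ge0E.
  - congr fine; apply: eq_esum => s _; congr EFin; rewrite normcE2.
    by case: (x s) => a b /=; rewrite mulrN opprK !expr2.
  - by move=> s; case: (x s) => a b /=; rewrite mulrN opprK addr_ge0// -expr2 sqr_ge0.
  - exact/Re_summable/fock_dot_summable.
rewrite (_ : (fun _ => _) = fun=> 0) ?rsum0//.
by apply/funext => s; case: (x s) => a b /=; rewrite mulrN mulrC addNr.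
Qed.

Lemma fock_dot_gt0 x : x != 0 -> 0 < fock_dot x x.
Proof.
move=> x0; rewrite fock_dotxx ltcR.
have /set_mem[_ sx] := fock_coefP x.
have [s xs0] : exists s, x s != 0.
  apply: contrapT => /forallNP h; move/eqP: x0; apply; apply: val_inj.
  by apply/funext => s; apply/eqP; have /negP := h s; rewrite negbK.
have p0 : 0 < normc (x s) ^+ 2.
  rewrite exprn_gt0// lt_neqAle normc_ge0 andbT eq_sym.
  by apply: contra_neq xs0 => /eq0_normc.
apply: fine_gt0; rewrite sx andbT.
apply: (@lt_le_trans _ _ (normc (x s) ^+ 2)%:E); first by rewrite lte_fin.
rewrite -(@esum_set1 R _ s (fun s => (normc (x s) ^+ 2)%:E)) ?lee_fin ?sqr_ge0//.
rewrite esum_mkcond; apply: le_esum => t _; case: ifP => // _.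
by rewrite lee_fin sqr_ge0.
Qed.

Lemma fock_dot_bilinear :
  bilinear_for *%R ((Num.conj : C -> C) \; *%R) fock_dot.
Proof.
split=> [y c x x'|x c y y'] /=; first exact: fock_dotDZ.
by rewrite fock_dotC fock_dotDZ rmorphD rmorphM (fock_dotC x y) (fock_dotC x y').
Qed.

HB.instance Definition _ := bilinear_isBilinear.Build C fock fock C
  *%R ((Num.conj : C -> C) \; *%R) fock_dot fock_dot_bilinear.
HB.instance Definition _ := isHermitianSesquilinear.Build C fock false
  Num.conj fock_dot (fun x y => etrans (fock_dotC x y) (esym (mul1r _))).
HB.instance Definition _ := isDotProduct.Build C fock fock_dot fock_dot_gt0.

End fock_space.

Section weighted_words.
Variable R : realType.
Implicit Types (a c : nat -> R) (A : R).

Lemma esum_words_size a A n : (forall j, 0 <= a j) ->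
  (\esum_(j in [set: nat]) (a j)%:E = A%:E)%E ->
  (\esum_(s in [set s : seq nat | size s = n]) (\prod_(j <- s) a j)%:E = (A ^+ n)%:E)%E.
Proof.
move=> a0 aA; have A0 : 0 <= A.
  by rewrite -lee_fin -aA; apply: esum_ge0 => j _; rewrite lee_fin.
have p0 s : 0 <= \prod_(j <- s) a j by apply: prodr_ge0.
elim: n => [|n IH].
  rewrite (_ : [set s | _] = [set [::]]).
    by rewrite esum_set1 ?big_nil ?expr0// lee_fin.
  by apply/seteqP; split => s /=; [exact: size0nil|move->].
rewrite (@reindex_esum _ _ _ ([set: nat] `*`` (fun=> [set s | size s = n]))
   _ (fun k => k.1 :: k.2)); last first.
  split.
  - by move=> [j s] /= [_ ->].
  - by move=> [j s] [j' s'] _ _ /= [-> ->].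
  - by move=> [//|j s] /= [sn]; exists (j, s).
rewrite -(@esum_esum _ _ _ _ _ (fun j s => (\prod_(i <- j :: s) a i)%:E)); last first.
  by move=> j s _ _; rewrite lee_fin.
transitivity (\esum_(j in [set: nat]) ((A ^+ n)%:E * (a j)%:E))%E.
  apply: eq_esum => j _; rewrite -IH muleC -esumZ//.
  by apply: eq_esum => s _; rewrite big_cons EFinM.
rewrite esumZ ?exprn_ge0//.
by rewrite aA -EFinM exprSr.
Qed.

Lemma esum_words a A : (forall j, 0 <= a j) ->
  (\esum_(j in [set: nat]) (a j)%:E = A%:E)%E ->
  (\esum_(s in [set: seq nat]) ((size s)`!%:R^-1 * \prod_(j <- s) a j)%:E
     = (expR A)%:E)%E.
Proof.
move=> a0 aA; have A0 : 0 <= A.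
  by rewrite -lee_fin -aA; apply: esum_ge0 => j _; rewrite lee_fin.
have p0 s : 0 <= \prod_(j <- s) a j by apply: prodr_ge0.
have -> : [set: seq nat] = \bigcup_(n in [set: nat]) [set s | size s = n].
  by apply/seteqP; split => // s _; exists (size s).
rewrite esum_bigcupT; last 2 first.
- by move=> i j _ _ [s [/= <- <-]].
- by move=> s; rewrite lee_fin mulr_ge0// invr_ge0.
transitivity (\esum_(n in [set: nat]) (exp_coeff A n)%:E)%E.
  apply: eq_esum => n _.
  transitivity (\esum_(s in [set s : seq nat | size s = n])
      ((n`!%:R^-1)%:E * (\prod_(j <- s) a j)%:E))%E.
    by apply: eq_esum => s /= ->; rewrite EFinM.
  rewrite esumZ ?invr_ge0//.
  by rewrite (esum_words_size n a0 aA) -EFinM mulrC.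
rewrite -nneseries_esumT; last by move=> n; rewrite lee_fin exp_coeff_ge0.
apply/cvg_lim => //.
rewrite (_ : (fun n => _) = EFin \o series (exp_coeff A)); last first.
  by apply/funext => n /=; rewrite sumEFin.
by apply: cvg_EFin; [exact: nearW|exact: is_cvg_series_exp_coeff].
Qed.

End weighted_words.

Section hilbert_space.
Variable R : realType.
Local Notation C := R[i].

Record inner_product (H : completeNormedModType C) := InnerProduct {
  ip :> {dot H for Num.conj};
  ip_norm : forall x, ip x x = `|x| ^+ 2 }.

Record orthonormal_basis (H : completeNormedModType C) (dot : inner_product H) :=
  OrthonormalBasis {
  basis :> nat -> H;
  basis_orthonormal : forall i j, dot (basis i) (basis j) = (i == j)%:R;
  basis_expansion : forall x,
    (fun N => \sum_(j < N) dot x (basis j) *: basis j) @ \oo --> x }.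

Arguments basis_expansion {H dot} _ _.

Variables (H : completeNormedModType C) (dot : inner_product H).
Variable e : orthonormal_basis dot.

Definition vnorm (x : H) : R := complex.Re `|x|.

Lemma vnormE x : `|x| = (vnorm x)%:C.
Proof. by rewrite /vnorm RRe_real// normr_real. Qed.

Lemma vnorm_ge0 x : 0 <= vnorm x.
Proof. by rewrite -ler0c -vnormE. Qed.

Definition coef (x : H) (j : nat) : C := dot x (e j).

Lemma vnormC2 x : dot x x = (vnorm x ^+ 2)%:C.
Proof. by rewrite ip_norm vnormE rmorphXn. Qed.

Lemma normcC2 (z : C) : (normc z ^+ 2)%:C = z * z^*.
Proof. by rewrite normcE2 add_Re2_Im2 -sqr_normc. Qed.

Lemma parseval_partial x N : vnorm x ^+ 2 =
  \sum_(j < N) normc (coef x j) ^+ 2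
  + vnorm (x - \sum_(j < N) coef x j *: e j) ^+ 2.
Proof.
apply: complexI; rewrite rmorphD rmorph_sum -!vnormC2 /=.
set p := \sum_(j < N) _ *: _.
have pe (j : 'I_N) : dot p (e j) = coef x j.
  rewrite linear_sumlz (bigD1 j)//= linearZl_LR/= basis_orthonormal eqxx mulr1.
  rewrite big1 ?addr0// => k kj; rewrite linearZl_LR/= basis_orthonormal.
  by rewrite (inj_eq val_inj) (negbTE kj) mulr0.
have pp : dot p p = \sum_(j < N) (normc (coef x j) ^+ 2)%:C.
  rewrite {2}/p linear_sumr; apply: eq_bigr => j _.
  by rewrite linearZr_LR/= pe normcC2 mulrC.
have rp : dot (x - p) p = 0.
  rewrite {2}/p linear_sumr big1// => j _.
  by rewrite linearZr_LR/= linearBl [X in _ - X]pe subrr mulr0.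
rewrite -pp -vnormC2 addrC -[in LHS](subrK p x).
exact: (@hnormDd _ _ _ _ dot).
Qed.

Lemma parseval x :
  (\esum_(j in [set: nat]) (normc (coef x j) ^+ 2)%:E = (vnorm x ^+ 2)%:E)%E.
Proof.
rewrite -nneseries_esumT; last by move=> n; rewrite lee_fin sqr_ge0.
apply/cvg_lim => //.
rewrite (_ : (fun n => _) = EFin \o (fun N => vnorm x ^+ 2 -
   vnorm (x - \sum_(j < N) coef x j *: e j) ^+ 2)); last first.
  by apply/funext => N /=; rewrite sumEFin (parseval_partial x N) big_mkord addrK.
apply: cvg_EFin; first exact: nearW.
rewrite -[X in _ --> X]subr0.
apply: cvgB; first exact: cvg_cst.
have h0 : vnorm (x - \sum_(j < N) coef x j *: e j) @[N --> \oo] --> 0.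
  apply/cvgrPdist_lt => eps eps0.
  have /cvgrPdist_lt/(_ eps%:C) := basis_expansion e x.
  rewrite ltcR => /(_ eps0); apply: filterS => N.
  by rewrite vnormE ltcR sub0r normrN ger0_norm// vnorm_ge0.
have h2 := cvgM h0 h0; rewrite mulr0 in h2.
exact: h2.
Qed.


(* |G(v)> = exp(-|v|^2/2) (+)_n (1/sqrt n!) v^{(x) n}, and the coefficient of
   v^{(x) n} on e_{j_1} (x) ... (x) e_{j_n} is \prod_k <e_{j_k}|v>. *)
Definition coherent_coef (v : H) (s : seq nat) : C :=
  (expR (- (vnorm v ^+ 2 / 2)))%:C
  * ((Num.sqrt (size s)`!%:R)^-1)%:C * \prod_(j <- s) coef v j.

Lemma esum_coherent_coef v :
  (\esum_(s in [set: seq nat]) (normc (coherent_coef v s) ^+ 2)%:E = 1)%E.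
Proof.
transitivity (\esum_(s in [set: seq nat])
   ((expR (- vnorm v ^+ 2))%:E *
    ((size s)`!%:R^-1 * \prod_(j <- s) (normc (coef v j) ^+ 2))%:E))%E.
  apply: eq_esum => s _; rewrite -EFinM; congr EFin.
  have normcR (z : R) : normc z%:C = `|z|.
    by rewrite /= expr0n addr0 sqrtr_sqr.
  rewrite /coherent_coef !normcM !normcR !exprMn !real_normK ?num_real//.
  rewrite exprVn sqr_sqrtr// -mulrA; congr (_ * (_ * _)).
    by rewrite -expRM_natl; congr expR; rewrite -mulr_natl; lra.
  rewrite (big_morph _ (@normcM R) (@normc1 R)).
  by rewrite (big_morph (fun z => z ^+ 2) (fun x y => exprMn 2 x y) (expr1n R 2)).
rewrite esumZ ?expR_ge0//; last first.
  move=> s; rewrite lee_fin mulr_ge0 ?invr_ge0// prodr_ge0// => j _.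
  exact: sqr_ge0.
rewrite (@esum_words _ (fun j => normc (coef v j) ^+ 2) (vnorm v ^+ 2)).
- by rewrite -EFinM -expRD addNr expR0.
- by move=> j; exact: sqr_ge0.
- exact: parseval.
Qed.

Lemma coherent_coefP v : coherent_coef v \in @fock_pred R.
Proof.
apply/mem_set; split; last by rewrite esum_coherent_coef ltry.
by move=> s t st; rewrite /coherent_coef (perm_size st) (perm_big _ st).
Qed.

Definition coherent (v : H) : fock R := Fock (coherent_coefP v).

Lemma coherent_norm v : fock_dot (coherent v) (coherent v) = 1.
Proof. by rewrite fock_dotxx esum_coherent_coef. Qed.

End hilbert_space.

Section measurements.
Variable R : realType.
Local Notation C := R[i].

(* A positive operator valued measure on the Fock space; the series in the
   sigma-additivity axiom converges in the weak operator topology. No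
   boundedness has to be required: the axioms give 0 <= M(E) <= 1. The values
   of M on non-measurable sets are irrelevant. *)
Record povm d (T : measurableType d) := Povm {
  effect :> set T -> {linear fock R -> fock R};
  effect_ge0 : forall E, measurable E -> forall x, 0 <= fock_dot (effect E x) x;
  effect_sigma_additive : forall E : nat -> set T,
    (forall i, measurable (E i)) -> trivIset setT E -> forall x y,
    (fun n => \sum_(i < n) fock_dot (effect (E i) x) y : C^o) @ \oo -->
      (fock_dot (effect (\bigcup_i E i) x) y : C^o);
  effectT : forall x, effect setT x = x }.

Arguments effect_sigma_additive {d T} _ {E} _ _ _ _.

Section law.
Context d (T : measurableType d).
Variables (M : povm T) (x : fock R).

(* E |-> <x|M(E)|x>. This is a nonnegative real when E is measurable (bornE);
   the modulus only makes it a total nonnegative set function. *)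
Definition born E : \bar R := (normc (fock_dot (M E x) x))%:E.

Lemma bornE E : measurable E -> (normc (fock_dot (M E x) x))%:C = fock_dot (M E x) x.
Proof. by move=> mE; have := ger0_norm (effect_ge0 M mE x). Qed.

Let born0 : born set0 = 0%E.
Proof.
set a := fock_dot (M set0 x) x.
have t0 : trivIset setT (fun _ : nat => set0 : set T) by move=> i j _ _ [y []].
have := effect_sigma_additive M (fun=> measurable0) t0 x x.
rewrite bigcup0// -/a => /cvgrPdist_lt h.
apply/eqP; rewrite eqe; apply/negP => /negP a0.
have {}a0 : a != 0.
  by apply/eqP => az; move/eqP: a0; apply; rewrite -/a az; exact: normc0.
have [|N _ /(_ N.+2)] := h `|a|; first by rewrite normr_gt0.
rewrite /= leqW// => /(_ isT).
rewrite sumr_const card_ord mulrS opprD addrA subrr sub0r normrN normrMn.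
rewrite mulrS gtrDl => /(le_lt_trans (mulrn_wge0 N (normr_ge0 a))).
by rewrite ltxx.
Qed.

Let born_ge0 E : (0 <= born E)%E.
Proof. by rewrite lee_fin normc_ge0. Qed.

Let born_sigma_additive : semi_sigma_additive born.
Proof.
move=> E mE tE mU; pose r i := normc (fock_dot (M (E i) x) x).
have := effect_sigma_additive M mE tE x x.
rewrite -(bornE mU) (_ : (fun n => _) = (fun n =>
    (\sum_(i < n) r i)%:C)); last first.
  by apply/funext => n; rewrite rmorph_sum; apply: eq_bigr => i _; exact: (esym (bornE (mE i))).
rewrite /born; move: (normc _) => l h.
rewrite (_ : (fun n => _) = EFin \o (fun n => \sum_(i < n) r i)); last first.
  by apply/funext => n /=; rewrite sumEFin big_mkord.
apply: cvg_EFin; first exact: nearW.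
apply/cvgrPdist_lt => eps eps0.
move/cvgrPdist_lt : h => /(_ eps%:C); rewrite ltcR => /(_ eps0).
apply: filterS => n.
by rewrite -rmorphB normc_def/= expr0n addr0 sqrtr_sqr ltcR.
Qed.

HB.instance Definition _ := isMeasure.Build _ _ _ born
  born0 born_ge0 born_sigma_additive.

End law.

Section outcome.
Context d (T : measurableType d) (H : completeNormedModType C)
  (dot : inner_product H) (e : orthonormal_basis dot).
Variables (M : povm T) (v : H).

Definition outcome_law : set T -> \bar R := born M (coherent e v).

HB.instance Definition _ := Measure.on outcome_law.

Let outcome_lawT : outcome_law setT = 1%E.
Proof. by rewrite /outcome_law /born effectT coherent_norm normc1. Qed.

HB.instance Definition _ := Measure_isProbability.Build _ _ _ outcome_law outcome_lawT.

End outcome.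
End measurements.

Section risk.
Context (R : realType) (H : completeNormedModType R[i]) (dot : inner_product H)
  (e : orthonormal_basis dot).

Definition ketbra (psi : H) : H -> H := fun x => dot x psi *: psi.

(* For alpha > 0 the term j = 0 vanishes since 0 `^ (2 * alpha) = 0. *)
Definition hermite_sobolev (alpha L : R) : set (H -> H) :=
  [set ketbra psi | psi in [set psi |
    (\sum_(0 <= j <oo)
       (normc (dot psi (e j)) ^+ 2 * j%:R `^ (2 * alpha))%:E <= L%:E)%E /\
    `|psi| = 1]].

(* A measurement with an arbitrary outcome space, followed by a Borel
   measurable H-valued function of the outcome. *)
Record estimator := Estimator {
  est_display : measure_display;
  outcome : measurableType est_display;
  measurement : povm R outcome;
  estimate :> outcome -> H;
  estimate_measurable : forall U, open U -> measurable (estimate @^-1` U) }.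

(* E_psi [ |estimate - psi|^2 ] for the outcome of the measurement performed
   on |G(sqrt n psi)>. *)
Definition risk (n : nat) (t : estimator) (psi : H) : \bar R :=
  ('E_(outcome_law e (measurement t) ((Num.sqrt n%:R)%:C *: psi))
    [(fun o => vnorm (t o - psi) ^+ 2)%R])%E.

End risk.

(* Main.v *)
(* Assouad's method with a quantum two-point test.  With delta^2 = kappa / n and
   N ~ n^(1/(2 alpha+1)), consider the 2^N unit vectors
   s e_0 + delta \sum_i e_(2i+1 or 2i+2), one bit per i; for small kappa they
   all lie in the Sobolev ellipsoid. Reading off bit i from the coordinate of
   the estimate on e_(2i+1), each wrong bit costs delta^2 / 4. Flipping a bit
   moves the vector by sqrt 2 delta, so the two coherent states have overlap
   rho = exp(- n delta^2) = exp(- kappa), and for any effect M(E)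
   <x|M(E^c)|x> + <y|M(E)|y> >= <x|y>^2 / 2. Averaging over the cube gives a
   vector of risk at least N delta^2 rho^2 / 16 ~ n^(- 2 alpha/(2 alpha+1)). *)
Require Import Defs.
From mathcomp Require Import all_boot all_order all_algebra.
From mathcomp Require Import complex ring lra.
From mathcomp Require Import all_classical all_reals all_analysis measurable_realfun.
Import Order.TTheory GRing.Theory Num.Theory.
Import numFieldNormedType.Exports Normc.
Local Open Scope classical_set_scope.
Local Open Scope ring_scope.
Local Open Scope complex_scope.

(** * Testing two pure states with an effect *)

Lemma fock_dotDD {R : realType} (x y z w : fock R) :
  fock_dot (x + y) (z + w) =
  fock_dot x z + fock_dot x w + (fock_dot y z + fock_dot y w).
Proof. by rewrite linearDl !linearDr. Qed.

Section two_point_test.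
Context {R : realType} {d : measure_display} {T : measurableType d}.
Variable M : povm R T.
Implicit Types (x y : fock R) (E : set T).

(** Additivity of the Born measure of [x] on the partition of the outcome space into [E] and its
    complement; the total mass is <x|x> since M(T) = 1. *)
Lemma effect_setC_diag E x : measurable E ->
  fock_dot (M E x) x + fock_dot (M (~` E) x) x = fock_dot x x.
Proof.
move=> mE; have mE' := measurableC mE.
have <- : fock_dot (M setT x) x = fock_dot x x by rewrite effectT.
rewrite -(bornE M x mE) -(bornE M x mE').
rewrite -(bornE M x measurableT) -rmorphD; congr (_%:C).
apply: EFin_inj; rewrite EFinD -/(born M x E) -/(born M x (~` E)).
by rewrite -/(born M x setT) -(setUv E) measureU// setICr.
Qed.

(* Expansion of <l x - y|M(E)|l x - y> >= 0. *)
Lemma effect_cross E x y (l : R) : measurable E ->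
  l%:C * (fock_dot (M E x) y + fock_dot (M E y) x) <=
  (l ^+ 2)%:C * fock_dot (M E x) x + fock_dot (M E y) y.
Proof.
move=> mE; have := effect_ge0 M mE (l%:C *: x - y).
rewrite linearB linearZ/= linearBl linearZl_LR/= !linearBr !linearZr_LR/=.
rewrite [Num.conj _]conjc_real -[in X in _ -> X]subr_ge0 => h; apply: (le_trans h).
rewrite rmorphXn/= le_eqVlt; apply/orP; left; apply/eqP; ring.
Qed.

(** Polarization: this is [effect_setC_diag] at [x + y] minus its instances at [x] and [y]. *)
Lemma effect_setC_cross E x y : measurable E ->
  (fock_dot (M E x) y + fock_dot (M E y) x) +
  (fock_dot (M (~` E) x) y + fock_dot (M (~` E) y) x) =
  fock_dot x y + fock_dot y x.
Proof.
move=> mE; have := effect_setC_diag E (x + y) mE.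
have := effect_setC_diag E x mE; have := effect_setC_diag E y mE.
rewrite !linearD/= !fock_dotDD => hy hx hxy.
apply: (@addIr _ (fock_dot x x + fock_dot y y)).
transitivity (fock_dot x x + fock_dot x y + (fock_dot y x + fock_dot y y)); last by ring.
by rewrite -hxy -hx -hy; ring.
Qed.

(** Add [effect_cross] for (E, x, y) and for (E^c, y, x) with l = rho / 2. If q is the sum of the
    two error probabilities, the correct decisions have total probability 2 - q, so rho^2 <= rho^2 /
    4 * (2 - q) + q, whence rho^2 / 2 <= q. *)
Lemma two_point_test E x y (rho : R) : measurable E ->
  fock_dot x x = 1 -> fock_dot y y = 1 ->
  fock_dot x y = rho%:C -> fock_dot y x = rho%:C ->
  ((rho ^+ 2 / 2)%:E <= born M x (~` E) + born M y E)%E.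
Proof.
move=> mE xx yy xy yx; have mE' := measurableC mE.
have hc := lerD (effect_cross E x y (rho / 2) mE)
  (effect_cross (~` E) y x (rho / 2) mE').
rewrite -mulrDr [X in _ * (_ + X)]addrC effect_setC_cross// xy yx in hc.
have hx := effect_setC_diag E x mE; have hy := effect_setC_diag E y mE.
have ex := esym (bornE M x mE); have ex' := esym (bornE M x mE').
have ey := esym (bornE M y mE); have ey' := esym (bornE M y mE').
rewrite /born -EFinD lee_fin.
move: (normc _) (normc_ge0 (fock_dot (M (~` E) x) x)) ex' => qx qx0 ex'.
move: (normc _) (normc_ge0 (fock_dot (M E y) y)) ey => py py0 ey.
move: (normc _) ex (normc _) ey' => px ex qy ey'.
move: hx hy hc; rewrite ex ex' ey ey' xx yy -(rmorph1 (real_complex R)).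
rewrite -!(rmorphD, rmorphM) lecR => /complexI hx /complexI hy.
have -> : px = 1 - qx by rewrite -hx addrK.
have -> : qy = 1 - py by rewrite -hy addrAC subrr add0r.
have : 0 <= rho ^+ 2 * (qx + py).
  by rewrite mulr_ge0 ?sqr_ge0// addr_ge0.
lra.
Qed.
End two_point_test.

(** * Overlap of coherent states *)

Section coherent_overlap.
Context {R : realType}.

Lemma csum_real (T : choiceType) (g : T -> R) : (forall i, 0 <= g i) ->
  rsummable g ->
  csum (fun i => (g i)%:C) = (fine (\esum_(i in setT) (g i)%:E))%:C.
Proof. by move=> g0 sg; rewrite /csum /= rsum_ge0E// rsum0. Qed.

Context {H : completeNormedModType R[i]} {dot : inner_product H}.
Variable e : orthonormal_basis dot.
Implicit Types u v : H.

(** Polarization of Parseval, from the norms of u, v and u - v. Nonnegative coefficients are real,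
    and the cross terms can be summed by [\esum]. *)
Lemma esum_coefM u v : (forall j, 0 <= coef e u j) -> (forall j, 0 <= coef e v j) ->
  (\esum_(j in [set: nat]) (complex.Re (coef e u j) * complex.Re (coef e v j))%:E =
   ((vnorm u ^+ 2 + vnorm v ^+ 2 - vnorm (u - v) ^+ 2) / 2)%:E)%E.
Proof.
move=> u0 v0.
pose a j := complex.Re (coef e u j); pose b j := complex.Re (coef e v j).
have aE j : coef e u j = (a j)%:C by rewrite RRe_real// ger0_real.
have bE j : coef e v j = (b j)%:C by rewrite RRe_real// ger0_real.
have a0 j : 0 <= a j by rewrite -ler0c -aE.
have b0 j : 0 <= b j by rewrite -ler0c -bE.
have nE (x : R) : normc x%:C ^+ 2 = x ^+ 2.
  by rewrite normcE2 /= expr0n addr0.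
have abE j : coef e (u - v) j = (a j - b j)%:C.
  by rewrite rmorphB/= -aE -bE /coef linearBl.
have pu : (\esum_(j in [set: nat]) (a j ^+ 2)%:E = (vnorm u ^+ 2)%:E)%E.
  rewrite -(parseval e u); apply: eq_esum => j _. by rewrite aE nE.
have pv : (\esum_(j in [set: nat]) (b j ^+ 2)%:E = (vnorm v ^+ 2)%:E)%E.
  by rewrite -(parseval e); apply: eq_esum => j _; rewrite bE nE.
have puv : (\esum_(j in [set: nat]) ((a j - b j) ^+ 2)%:E =
    (vnorm (u - v) ^+ 2)%:E)%E.
  by rewrite -(parseval e); apply: eq_esum => j _; rewrite abE nE.
have : ((\esum_(j in [set: nat]) ((a j - b j) ^+ 2)%:E) +
    2%:E * (\esum_(j in [set: nat]) (a j * b j)%:E) =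
    (\esum_(j in [set: nat]) (a j ^+ 2)%:E) +
    (\esum_(j in [set: nat]) (b j ^+ 2)%:E))%E.
  rewrite -(@esumZ _ _ _ 2 (fun j => (a j * b j)%:E))//; last first.
    by move=> j; rewrite lee_fin mulr_ge0.
  rewrite -!esumD; try by move=> j _; rewrite -?EFinM lee_fin ?sqr_ge0 ?mulr_ge0.
  by apply: eq_esum => j _; rewrite -EFinM -!EFinD; congr EFin; ring.
have : (0 <= \esum_(j in [set: nat]) (a j * b j)%:E)%E.
  by apply: esum_ge0 => j _; rewrite lee_fin mulr_ge0.
rewrite pu pv puv -/a -/b.
(* Nonnegativity excludes the value -oo, and the finite right-hand side excludes +oo. *)
move: (\esum_(j in _) _)%E => [r||] // _.
- by rewrite -EFinM -!EFinD => -[h]; congr EFin; lra.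
- by rewrite mulry gtr0_sg// mul1e.
Qed.

(** Multiplying coefficients word by word gives 1 / n! times a product of the a_j b_j, and
    [esum_words] sums these to exp <u, v>. The normalizing factors complete the square in the
    exponent. *)
Lemma coherent_dot u v : (forall j, 0 <= coef e u j) -> (forall j, 0 <= coef e v j) ->
  fock_dot (coherent e u) (coherent e v) =
  (expR (- (vnorm (u - v) ^+ 2 / 2)))%:C.
Proof.
move=> u0 v0; have ab := esum_coefM u v u0 v0; move: ab.
pose a j := complex.Re (coef e u j); pose b j := complex.Re (coef e v j).
have aE j : coef e u j = (a j)%:C by rewrite RRe_real// ger0_real.
have bE j : coef e v j = (b j)%:C by rewrite RRe_real// ger0_real.
have ab0 j : 0 <= a j * b j by rewrite mulr_ge0// -ler0c -?aE -?bE.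
move=> ab; have := esum_words ab0 ab.
set A := (X in expR X).
set E := expR (- (vnorm u ^+ 2 / 2)) * expR (- (vnorm v ^+ 2 / 2)).
have E0 : 0 <= E by rewrite mulr_ge0 ?expR_ge0.
pose g (s : seq nat) := (size s)`!%:R^-1 * \prod_(j <- s) (a j * b j).
have g0 s : 0 <= g s by rewrite mulr_ge0 ?invr_ge0// prodr_ge0.
rewrite -/g => gE.
have Eg : (\esum_(s in [set: seq nat]) (E * g s)%:E = (E * expR A)%:E)%E.
  under eq_esum do rewrite EFinM.
  by rewrite (@esumZ _ _ _ E (fun s => (g s)%:E))// gE.
have Eg0 s : 0 <= E * g s by rewrite mulr_ge0.
rewrite /fock_dot (_ : (fun s => _) = (fun s => (E * g s)%:C)).
  rewrite csum_real// ?Eg/=; last first.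
    rewrite /rsummable /summable.
    by under eq_esum do rewrite /= ger0_norm//; rewrite Eg ltry.
  congr (_%:C); rewrite /E -!expRD; congr expR; rewrite /A; lra.
apply/funext => s; rewrite /= /coherent_coef.
have prodE (w : H) (f : nat -> R) : (forall j, coef e w j = (f j)%:C) ->
    \prod_(j <- s) coef e w j = (\prod_(j <- s) f j)%:C.
  by move=> wf; rewrite rmorph_prod; apply: eq_bigr => j _; rewrite wf.
rewrite (prodE _ _ aE) (prodE _ _ bE) -!rmorphM/= [Num.conj _]conjc_real.
rewrite -rmorphM.
congr (_%:C); rewrite /E /g big_split/=.
rewrite -[in RHS](sqr_sqrtr (ler0n R (size s)`!)) expr2 invfM.
by ring.
Qed.

End coherent_overlap.

(** * The cube of hypotheses inside the Sobolev ellipsoid *)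

Section hypercube.
Context {R : realType} {H : completeNormedModType R[i]} {dot : inner_product H}.
Variable e : orthonormal_basis dot.

Lemma vnormZ (c : R) (x : H) : vnorm (c%:C *: x) ^+ 2 = c ^+ 2 * vnorm x ^+ 2.
Proof.
apply: complexI; rewrite [RHS]rmorphM/= -!(vnormC2 dot) linearZl_LR linearZr_LR/=.
by rewrite [Num.conj _]conjc_real mulrA -expr2 rmorphXn.
Qed.

Lemma vnormDd (x y : H) : dot x y = 0 ->
  vnorm (x + y) ^+ 2 = vnorm x ^+ 2 + vnorm y ^+ 2.
Proof.
move=> xy; apply: complexI; rewrite rmorphD/= -!(vnormC2 dot).
exact: (@hnormDd _ _ _ _ dot).
Qed.

Lemma vnorm_basis j : vnorm (e j) ^+ 2 = 1.
Proof. by apply: complexI; rewrite -(vnormC2 dot) basis_orthonormal eqxx. Qed.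

Lemma coef_basis i j : coef e (e i) j = (i == j)%:R.
Proof. by rewrite /coef basis_orthonormal. Qed.

Lemma basis_coefD (x y : H) j : coef e (x + y) j = coef e x j + coef e y j.
Proof. by rewrite /coef linearDl. Qed.

Lemma basis_coefB (x y : H) j : coef e (x - y) j = coef e x j - coef e y j.
Proof. by rewrite /coef linearBl. Qed.

Lemma basis_coefZ c (x : H) j : coef e (c *: x) j = c * coef e x j.
Proof. by rewrite /coef linearZl_LR. Qed.

Lemma coef_sum_basis (I : finType) (p : I -> nat) j :
  coef e (\sum_i e (p i)) j = (\sum_i (p i == j))%:R.
Proof.
rewrite /coef linear_sumlz natr_sum; apply: eq_bigr => i _.
exact: basis_orthonormal.
Qed.

Lemma vnorm_sum_basis (I : finType) (p : I -> nat) : injective p ->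
  vnorm (\sum_i e (p i)) ^+ 2 = #|I|%:R.
Proof.
move=> p_inj; apply: complexI; rewrite -(vnormC2 dot) linear_sumr.
rewrite (eq_bigr (fun=> 1)) ?sumr_const ?rmorph_nat// => i _.
rewrite [LHS](coef_sum_basis _ p (p i)) (bigD1 i)//= eqxx big1 ?addn0// => k ki.
by rewrite (inj_eq p_inj) (negbTE ki).
Qed.

Context {N : nat}.
Implicit Types (s delta : R) (w : {ffun 'I_N -> bool}).

(* The i-th bit of w selects one of the basis vectors of index 2i+1 and 2i+2,
   so that the norm does not depend on w. *)
Definition cube_index w (i : 'I_N) : nat := (i.*2.+1 + ~~ w i)%N.

(** The component on e_0 has weight 0 in the Sobolev sum, so [s] can be used freely to normalize. *)
Definition cube_vec s delta w : H :=
  s%:C *: e 0%N + delta%:C *: \sum_i e (cube_index w i).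

Definition flip (i : 'I_N) w : {ffun 'I_N -> bool} :=
  [ffun k => (k == i) (+) w k].

Lemma flipK i : involutive (flip i).
Proof. by move=> w; apply/ffunP => k; rewrite !ffunE addbA addbb. Qed.

(** Decoding the position from the index: distinct positions use disjoint pairs of basis vectors, so
    only bit i can reach index 2i+1. *)
Lemma cube_index_half w i : (cube_index w i).-1./2 = i.
Proof.
rewrite /cube_index addSn/= halfD odd_double/= add0n doubleK.
by case: (w i); rewrite addn0.
Qed.

Lemma cube_index_inj w : injective (cube_index w).
Proof.
by move=> i k ik; apply: val_inj; rewrite /= -(cube_index_half w i) ik cube_index_half.
Qed.

Lemma cube_index_le w i : (cube_index w i <= N.*2)%N.
Proof.
have := ltn_ord i; rewrite -leq_double doubleS; apply: leq_trans.
by rewrite /cube_index addSn ltnS -[X in (_ <= X)%N]addn1 leq_add2l; case: (w i).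
Qed.

Lemma coef_cube_vec s delta w j : coef e (cube_vec s delta w) j =
  (s * (j == 0%N)%:R + delta * (\sum_i (cube_index w i == j))%:R)%:C.
Proof.
rewrite basis_coefD !basis_coefZ coef_basis coef_sum_basis rmorphD !rmorphM !rmorph_nat.
by rewrite eq_sym.
Qed.

Lemma coef_cube_vec_ge0 s delta w j : 0 <= s -> 0 <= delta ->
  0 <= coef e (cube_vec s delta w) j.
Proof.
by move=> s0 d0; rewrite coef_cube_vec ler0c addr_ge0// mulr_ge0.
Qed.

Lemma coef_cube_vec_bit s delta w (i : 'I_N) :
  coef e (cube_vec s delta w) i.*2.+1 = (delta * (w i)%:R)%:C.
Proof.
rewrite coef_cube_vec/= mulr0 add0r (bigD1 i)//= big1 ?addn0.
  by rewrite /cube_index -[X in _ == X]addn0 eqn_add2l; case: (w i).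
move=> k ki; case: eqP => // ik; move: ki; rewrite -(inj_eq val_inj)/=.
by rewrite -(cube_index_half w k) ik /= doubleK eqxx.
Qed.

Lemma vnorm_cube_vec s delta w :
  vnorm (cube_vec s delta w) ^+ 2 = s ^+ 2 + delta ^+ 2 * N%:R.
Proof.
rewrite vnormDd ?vnormZ ?vnorm_basis ?vnorm_sum_basis ?card_ord ?mulr1//.
  exact: cube_index_inj.
rewrite linearZl_LR linearZr_LR/= linear_sumr big1 ?mulr0// => i _.
exact: (etrans (basis_orthonormal e 0%N _)).
Qed.

Lemma vnorm_cube_vec_flip s delta w i :
  vnorm (cube_vec s delta w - cube_vec s delta (flip i w)) ^+ 2 = 2 * delta ^+ 2.
Proof.
rewrite opprD addrACA subrr add0r -scalerBr -sumrB (bigD1 i)//= big1 ?addr0.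
  rewrite vnormZ vnormDd.
    rewrite -scaleN1r -(rmorph1 (real_complex R)) -rmorphN vnormZ !vnorm_basis.
    lra.
  rewrite linearNr [X in - X](basis_orthonormal e) /cube_index eqn_add2l ffunE eqxx.
  by case: (w i); rewrite oppr0.
move=> k ki; rewrite [X in _ - e X](_ : _ = cube_index w k) ?subrr//.
by rewrite /cube_index ffunE (negbTE ki).
Qed.

(** Away from e_0 the vector is supported on indices at most 2N, so every weight is at most (2N)^(2
    alpha); Parseval for the part [z] without e_0 gives the mass delta^2 N. *)
Lemma cube_vec_sobolev (alpha L : R) s delta w : 0 < alpha ->
  s ^+ 2 + delta ^+ 2 * N%:R = 1 ->
  (N.*2)%:R `^ (2 * alpha) * (delta ^+ 2 * N%:R) <= L ->
  hermite_sobolev e alpha L (ketbra dot (cube_vec s delta w)).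
Proof.
move=> alpha0 s1 dL; exists (cube_vec s delta w) => //; split; last first.
  have : vnorm (cube_vec s delta w) ^+ 2 == 1 by rewrite vnorm_cube_vec s1.
  rewrite sqrf_eq1 vnormE => /predU1P[->//|/eqP vN1].
  by have := vnorm_ge0 (cube_vec s delta w); rewrite vN1 oppr_ge0 ler10.
rewrite nneseries_esumT; last first.
  by move=> n; rewrite lee_fin mulr_ge0 ?sqr_ge0 ?powR_ge0.
set z := delta%:C *: \sum_i e (cube_index w i).
apply: (@le_trans _ _ (\esum_(j in [set: nat])
    (((N.*2)%:R `^ (2 * alpha))%:E * (normc (coef e z j) ^+ 2)%:E))%E).
  apply: le_esum => j _; rewrite -EFinM lee_fin -/(coef e _ j).
  case: j => [|j].
    rewrite powR0 ?mulr0 ?mulf_neq0 ?gt_eqF//.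
    by apply: mulr_ge0; [exact: powR_ge0|exact: sqr_ge0].
  rewrite basis_coefD basis_coefZ coef_basis mulr0 add0r.
  have [jN|jN] := leqP j.+1 N.*2.
    rewrite mulrC ler_wpM2r ?sqr_ge0// ge0_ler_powR ?nnegrE ?ler_nat//.
    by rewrite mulr_ge0// ltW.
  rewrite basis_coefZ coef_sum_basis big1; last first.
    move=> i _; case: eqP => // ij; move: jN; rewrite -ij ltnNge.
    by rewrite cube_index_le.
  by rewrite mulr0 normc0 expr0n/= mul0r mulr0.
rewrite (@esumZ _ _ _ _ (fun j => (normc (coef e z j) ^+ 2)%:E)) ?powR_ge0//; last first.
  by move=> j; rewrite lee_fin sqr_ge0.
rewrite parseval -EFinM lee_fin vnormZ vnorm_sum_basis ?card_ord//.
exact: cube_index_inj.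
Qed.

End hypercube.

(** * From bit errors to the quadratic risk *)

Section risk_lower_bound.
Context {R : realType} {H : completeNormedModType R[i]} {dot : inner_product H}.
Variable e : orthonormal_basis dot.

Lemma normr_vnormB (x y : H) : `|vnorm x - vnorm y| <= vnorm (x - y).
Proof.
rewrite -lecR; have := ler_dist_dist x y; rewrite !(@vnormE _ H) -rmorphB.
by rewrite normc_def/= expr0n addr0 sqrtr_sqr.
Qed.

Lemma bessel (x : H) n : \sum_(j < n) normc (coef e x j) ^+ 2 <= vnorm x ^+ 2.
Proof. by rewrite (parseval_partial e x n) lerDl sqr_ge0. Qed.

Lemma bessel_odd (x : H) n :
  \sum_(i < n) normc (coef e x i.*2.+1) ^+ 2 <= vnorm x ^+ 2.
Proof.
apply: le_trans (bessel x n.*2); elim: n => [|n IH]; first by rewrite !big_ord0.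
by rewrite doubleS !big_ord_recr/= lerD2r ler_wpDr// sqr_ge0.
Qed.

Lemma Re_coef_le (x : H) j : `|complex.Re (coef e x j)| <= vnorm x.
Proof.
rewrite -ler_sqr ?nnegrE ?vnorm_ge0// real_normK ?num_real//.
apply: le_trans (bessel x j.+1); rewrite big_ord_recr/= normcE2.
rewrite ler_wpDl ?lerDl ?sqr_ge0//; apply: sumr_ge0 => k _; exact: sqr_ge0.
Qed.

Lemma lipschitz_continuous (g : H -> R) :
  (forall x y, `|g x - g y| <= vnorm (x - y)) -> continuous g.
Proof.
move=> gL x; apply/cvgrPdist_lt => eps eps0.
have /cvgrPdist_lt/(_ eps%:C) := @cvg_id _ (nbhs x).
rewrite ltcR => /(_ eps0); apply: filterS => y.
by rewrite vnormE ltcR; apply: le_lt_trans.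
Qed.

(** Open intervals generate the Borel sets of the line, and their preimages under [g] are open,
    which is all that an estimator's measurability covers. *)
Lemma estimator_measurable (t : estimator H) (g : H -> R) : continuous g ->
  measurable_fun setT (g \o t).
Proof.
move=> /continuousP gC; apply: (measurability _ (RGenOpens.measurableE R)).
move=> _ [_ [a [b ->]] <-]; rewrite setTI comp_preimage.
exact/estimate_measurable/gC/interval_open.
Qed.

(** Pointwise, the sum of c times the indicators of the [A i] is at most the sum of squared odd
    coordinates of the error, hence at most its squared norm by [bessel_odd]. Integrate against the
    outcome law. *)
Lemma risk_ge n (t : estimator H) (psi : H) N (c : R)
    (A : 'I_N -> set (outcome t)) :
  0 <= c -> (forall i, measurable (A i)) ->
  (forall i o, A i o -> c <= normc (coef e (t o - psi) i.*2.+1) ^+ 2) ->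
  (\sum_(i < N) c%:E *
     born (measurement t) (coherent e ((Num.sqrt n%:R)%:C *: psi)) (A i) <=
   risk e n t psi)%E.
Proof.
move=> c0 mA cA; rewrite /risk expectation.unlock.
set P := outcome_law _ _ _.
rewrite [leLHS](_ : _ = (\int[P]_o \sum_(i < N) (c%:E * (\1_(A i) o)%:E))%E).
  apply: ge0_le_integral => //.
  - by move=> o _; apply: sume_ge0 => i _; rewrite mule_ge0// lee_fin.
  - apply: emeasurable_sum => i; apply: measurable_funeM.
    exact/measurable_EFinP/measurable_indic.
  - apply/measurable_EFinP; apply: measurable_funX.
    apply: (@estimator_measurable t (fun h => vnorm (h - psi))).
    apply: lipschitz_continuous => x y; apply: le_trans (normr_vnormB _ _) _.
    by rewrite opprB addrA subrK.
  move=> o _; apply: le_trans (_ : (\sum_(i < N)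
      normc (coef e (t o - psi) i.*2.+1) ^+ 2)%:E <= _)%E; last first.
    by rewrite lee_fin bessel_odd.
  rewrite -sumEFin; apply: lee_sum => i _; rewrite -EFinM lee_fin indicE.
  by case: (boolP (o \in A i)) => [/set_mem/cA|_]; rewrite ?mulr1 ?mulr0 ?sqr_ge0.
rewrite ge0_integral_sum//.
- apply: eq_bigr => i _; rewrite ge0_integralZl_EFin//.
  + by rewrite integral_indic// setIT.
  + exact/measurable_EFinP/measurable_indic.
- by move=> i; apply: measurable_funeM; exact/measurable_EFinP/measurable_indic.
- by move=> i o _; rewrite mule_ge0// lee_fin.
Qed.

End risk_lower_bound.

(** * Averaging over the cube *)

Section assouad.
Context {R : realType} {H : completeNormedModType R[i]} {dot : inner_product H}.
Variable e : orthonormal_basis dot.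

Lemma exists_ge_average (I : finType) (f : I -> R) (b : R) :
  (0 < #|I|)%N -> #|I|%:R * b <= \sum_i f i -> exists i, b <= f i.
Proof.
move=> /card_gt0P[i0 _] bf; apply: contrapT => /forallNP fb.
move: bf; apply/negP; rewrite -ltNge mulr_natl -sumr_const.
apply: ltr_sum => [|i _]; first by apply/hasP; exists i0; rewrite ?mem_index_enum.
by have /negP := fb i; rewrite -ltNge.
Qed.

Lemma assouad n (t : estimator H) N (s delta : R) : 0 <= s -> 0 <= delta ->
  exists w : {ffun 'I_N -> bool},
    ((N%:R * delta ^+ 2 * expR (- (n%:R * delta ^+ 2)) ^+ 2 / 16)%:E <=
     risk e n t (cube_vec e s delta w))%E.
Proof.
move=> s0 d0; set rho := expR _.
(* The event that bit i is read as true: the true coordinate is delta or 0, so the threshold is the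
   midpoint. *)
pose A (i : 'I_N) := [set o | delta / 2 <= complex.Re (coef e (t o) i.*2.+1)].
have mA i : measurable (A i).
  have /(_ measurableT _ (measurable_itv `[delta / 2, +oo[)) :
      measurable_fun setT (fun o => complex.Re (coef e (t o) i.*2.+1)).
    apply: (@estimator_measurable _ _ t (fun h => complex.Re (coef e h i.*2.+1))).
    apply: lipschitz_continuous => x y; apply: le_trans (Re_coef_le e _ i.*2.+1).
    by rewrite basis_coefB raddfB.
  rewrite setTI; congr measurable; apply/seteqP; split => o /=.
    by rewrite in_itv/= andbT.
  by rewrite in_itv/= andbT.
(* The event that bit i is read wrongly when [w] is the truth. *)
pose err (w : {ffun 'I_N -> bool}) i := if w i then ~` A i else A i.
have merr (w : {ffun 'I_N -> bool}) i : measurable (err w i).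
  by rewrite /err; case: (w i) => //; exact: measurableC.
pose G (w : {ffun 'I_N -> bool}) :=
  coherent e ((Num.sqrt n%:R)%:C *: cube_vec e s delta w).
pose p (w : {ffun 'I_N -> bool}) i :=
  normc (fock_dot (measurement t (err w i) (G w)) (G w)).
have overlap (w : {ffun 'I_N -> bool}) i : fock_dot (G w) (G (flip i w)) = rho%:C.
  have G0 v j : 0 <= coef e ((Num.sqrt n%:R)%:C *: cube_vec e s delta v) j.
    by rewrite basis_coefZ mulr_ge0 ?ler0c ?sqrtr_ge0// coef_cube_vec_ge0.
  rewrite coherent_dot//.
  rewrite -scalerBr (@vnormZ _ _ dot) sqr_sqrtr// vnorm_cube_vec_flip.
  by rewrite mulrCA mulrAC divff ?mul1r.
have pair (w : {ffun 'I_N -> bool}) i : rho ^+ 2 / 2 <= p w i + p (flip i w) i.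
  have o1 := overlap w i.
  have o2 : fock_dot (G (flip i w)) (G w) = rho%:C.
    by rewrite -{2}(flipK i w) overlap.
  rewrite /p /err ffunE eqxx; case: (w i) => /=.
    exact: (two_point_test (measurement t) (A i) (G w) (G (flip i w)) rho
      (mA i) (coherent_norm _ _) (coherent_norm _ _) o1 o2).
  rewrite addrC.
  exact: (two_point_test (measurement t) (A i) (G (flip i w)) (G w) rho
      (mA i) (coherent_norm _ _) (coherent_norm _ _) o2 o1).
set card : R := #|{ffun 'I_N -> bool}|%:R.
(* Flipping bit i permutes the cube, so summing [pair] counts each error probability twice; this
   halves rho^2 / 2. *)
have sump i : card * (rho ^+ 2 / 4) <= \sum_w p w i.
  set S := \sum_w p w i.
  have flipS : S = \sum_w p (flip i w) i.
    exact: (reindex_inj (inv_inj (flipK i))).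
  have : card * (rho ^+ 2 / 2) <= S + S.
    rewrite [in X in _ <= _ + X]flipS /S -big_split/= /card mulr_natl -sumr_const.
    by apply: ler_sum => w _; exact: pair.
  move: S card {flipS} => S card; lra.
(* The 16 is 4 * 4: one factor from the cost delta^2 / 4 of a wrong bit, one from the mean error
   rho^2 / 4. *)
have [||w hw] := @exists_ge_average {ffun 'I_N -> bool}
    (fun w => \sum_i delta ^+ 2 / 4 * p w i) (N%:R * delta ^+ 2 * rho ^+ 2 / 16).
- by apply/card_gt0P; exists [ffun=> true].
- rewrite exchange_big/=.
  apply: (@le_trans _ _ (\sum_(i < N) delta ^+ 2 / 4 *
      (card * (rho ^+ 2 / 4)))).
    rewrite sumr_const card_ord -mulr_natl -/card; move: card {sump} => card; lra.
  apply: ler_sum => i _; rewrite -mulr_sumr ler_wpM2l//.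
  by rewrite divr_ge0 ?sqr_ge0.
exists w; apply: (@le_trans _ _ (\sum_i delta ^+ 2 / 4 * p w i)%:E).
  by rewrite lee_fin.
rewrite -sumEFin; under eq_bigr do rewrite EFinM.
apply: (@risk_ge _ _ _ e n t (cube_vec e s delta w) N (delta ^+ 2 / 4) (err w)).
- by rewrite divr_ge0 ?sqr_ge0.
- exact: merr.
move=> i o; rewrite normcE2 basis_coefB coef_cube_vec_bit /err /A raddfB/= => h.
(* A wrong reading puts the real part at distance at least delta / 2 from its true value. *)
apply: le_trans (_ : (complex.Re (coef e (t o) i.*2.+1) - delta * (w i)%:R) ^+ 2 <= _).
  by move: h; case: (w i) => /=; [move/negP; rewrite -ltNge|]; nra.
by rewrite lerDl sqr_ge0.
Qed.

End assouad.

(** * Choice of the parameters and passage to the limit *)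

Lemma limn_einf_ge (R : realType) (u : nat -> \bar R) (c : \bar R) m :
  (forall n, (m <= n)%N -> c <= u n)%E -> (c <= limn_einf u)%E.
Proof.
move=> cu; rewrite limn_einf_lim; apply: lime_ge; first exact: is_cvg_einfs.
exists m => // n /= mn; apply: le_ereal_inf_tmp => _ [k /= nk <-].
exact/cu/(leq_trans mn).
Qed.

(* With X = n `^ (1 / (2 alpha + 1)) the cube has N = floor X ~ X bits. *)
Lemma cube_dimension (R : realType) (alpha : R) n : 0 < alpha -> (0 < n)%N ->
  exists N : nat, [/\ N%:R <= n%:R :> R,
    (N.*2)%:R `^ (2 * alpha) * N%:R <= 2 `^ (2 * alpha) * n%:R &
    n%:R <= n%:R `^ (2 * alpha / (2 * alpha + 1)) * (2 * N%:R)].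
Proof.
move=> alpha0 n0; have a1 : 0 < 2 * alpha + 1 by lra.
set X : R := n%:R `^ (2 * alpha + 1)^-1.
have nR : 1 <= n%:R :> R by rewrite ler1n.
have X1 : 1 <= X.
  by rewrite -(powRr0 (n%:R : R)) ler_powR// invr_ge0 ltW.
have XD : X `^ (2 * alpha) * X = n%:R.
  have X0 : X != 0 by lra.
  rewrite -[X in _ * X = _]powRr1; last by lra.
  rewrite -powRD; last by rewrite X0 implybT.
  by rewrite /X -powRrM mulVf ?powRr1 ?gt_eqF.
have XE : X `^ (2 * alpha) = n%:R `^ (2 * alpha / (2 * alpha + 1)).
  by rewrite /X -powRrM mulrC.
have Xn : X <= n%:R.
  rewrite -XD ler_peMl ?(le_trans ler01 X1)//.
  by rewrite -[leLHS](powRr0 X) ler_powR// mulr_ge0// ltW.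
exists (Num.truncn X).
have NX : (Num.truncn X)%:R <= X by rewrite truncn_le (le_trans ler01 X1).
split; first exact: le_trans NX Xn.
  rewrite -muln2 mulnC natrM powRM// -mulrA ler_wpM2l ?powR_ge0//.
  rewrite -XD ler_pM ?powR_ge0// ge0_ler_powR ?nnegrE//.
    by rewrite mulr_ge0// ltW.
  exact: le_trans X1.
rewrite -XE -{1}XD ler_wpM2l ?powR_ge0//.
(* As floor X >= 1, X < floor X + 1 <= 2 floor X. *)
have := truncnS_gt X; rewrite -natr1 => XN.
have : 1 <= (Num.truncn X)%:R :> R by rewrite ler1n truncn_gt0.
lra.
Qed.

Theorem theorem5p2 (R : realType) (alpha L : R) (halpha : 0 < alpha) (hL : 0 < L) :
  exists2 c : R, 0 < c &
    forall (H : completeNormedModType R[i]) (dot : inner_product H)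
           (e : orthonormal_basis dot),
    (c%:E <= limn_einf (fun n : nat =>
       ereal_inf [set r | exists t : estimator H,
         r = ereal_sup [set
           (n%:R `^ (2 * alpha / (2 * alpha + 1)))%:E * risk e n t psi
         | psi in [set psi : H | hermite_sobolev e alpha L (ketbra dot psi)]]]))%E.
Proof.
set K : R := 2 `^ (2 * alpha).
have K0 : 0 < K by rewrite powR_gt0.
(* The bound 1 leaves room for a real [s] with s^2 = 1 - delta^2 N; the bound L / K places the cube
   in the ellipsoid. *)
pose kappa := Num.min 1 (L / K).
have k0 : 0 < kappa by rewrite lt_min ltr01 divr_gt0.
have k1 : kappa <= 1 by rewrite ge_min lexx.
have kL : K * kappa <= L.
  by rewrite mulrC -ler_pdivlMr// ge_min lexx orbT.
(* The 32 is the 16 of [assouad] times the factor 2 lost in rounding the dimension. *)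
exists (kappa * expR (- kappa) ^+ 2 / 32).
  by rewrite divr_gt0// mulr_gt0// exprn_gt0// expR_gt0.
(* Starting at n = 1 makes delta^2 = kappa / n meaningful; then n delta^2 = kappa keeps the overlap
   constant in n. *)
move=> H dot e; apply: (@limn_einf_ge _ _ _ 1) => n n1.
apply: le_ereal_inf_tmp => _ [t ->].
have [N [Nn NK nN]] := cube_dimension R alpha n halpha n1.
have n0 : 0 < n%:R :> R by rewrite ltr0n.
have d2 : Num.sqrt (kappa / n%:R) ^+ 2 = kappa / n%:R.
  by rewrite sqr_sqrtr// divr_ge0// ltW.
set delta := Num.sqrt _ in d2.
have dN : delta ^+ 2 * N%:R <= 1.
  rewrite d2 mulrAC ler_pdivrMr// mul1r.
  by apply: le_trans Nn; rewrite ler_piMl.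
pose s := Num.sqrt (1 - delta ^+ 2 * N%:R).
have s2 : s ^+ 2 + delta ^+ 2 * N%:R = 1 by rewrite sqr_sqrtr ?subrK// subr_ge0.
have [w hw] := assouad e n t N s delta (sqrtr_ge0 _) (sqrtr_ge0 _).
apply: le_ereal_sup_tmp.
exists ((n%:R `^ (2 * alpha / (2 * alpha + 1)))%:E *
  risk e n t (cube_vec e s delta w))%E.
  exists (cube_vec e s delta w) => //.
  apply: cube_vec_sobolev => //; rewrite d2.
  apply: le_trans kL; rewrite mulrCA mulrAC mulrCA -/K.
  by rewrite ler_pdivrMr// mulrCA [K * _]mulrC -mulrA ler_wpM2l// ltW.
apply: le_trans (lee_wpmul2l _ hw); last by rewrite lee_fin powR_ge0.
rewrite -EFinM lee_fin d2 [n%:R * _]mulrC divfK ?gt_eqF//.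
set Y := _ `^ _ in nN *.
(* Isolate the ratio of rate times 2N to n, which is at least 1 by [nN]. *)
rewrite [leRHS](_ : _ =
  Y * (2 * N%:R) / n%:R * (kappa * expR (- kappa) ^+ 2 / 32)); last first.
  by field; rewrite gt_eqF.
rewrite ler_peMl//; last by rewrite ler_pdivlMr// mul1r.
by rewrite divr_ge0// mulr_ge0 ?exprn_ge0 ?expR_ge0// ltW.
Qed.
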